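(* For $n\ge 1$ let $G_n^+=\overline{L_n}$ be the graph complement of the path graph $L_n$ with $n$ vertices. Then for every integer $d\ge 0$, the graph $G_{3d+1}^+$ is contractible, and the graphs $G_{3d+2}^+$ and $G_{3d+3}^+$ are homotopic to $d$-spheres.
   Context: All graphs are finite and simple. The unit sphere $S(x)$ of a vertex $x$ is the subgraph induced by the neighbors of $x$. A graph is contractible if it is the one-point graph $K_1$ or (inductively) if it has a vertex $x$ such that both $S(x)$ and the graph $G-x$ with $x$ removed are contractible. A homotopy extension of $G$ adds a new vertex joined exactly to the vertices of a contractible induced subgraph $A$ of $G$; a homotopy reduction is the reverse (removing a vertex $x$ with $S(x)$ contractible). Two graphs are homotopic if one is obtained from the other by finitely many homotopy extensions and reductions. Spheres are defined inductively: the empty graph is the $(-1)$-sphere, and for $d\ge 0$ a $d$-sphere is a graph all of whose unit spheres are $(d-1)$-spheres and which becomes contractible after removing some vertex. *)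

(* Defs.v *)
From mathcomp Require Import all_boot all_order all_algebra.

Set Implicit Arguments.
Unset Strict Implicit.
Unset Printing Implicit Defensive.

Record sgraph := SGraph {
  vertex :> finType;
  adj : rel vertex;
  adj_sym : symmetric adj;
  adj_irr : irreflexive adj }.

Definition iso (G H : sgraph) : Prop :=
  exists2 f : G -> H, bijective f & forall x y, adj (f x) (f y) = adj x y.

Section Constructions.
Variables (G : sgraph) (A : {set G}).

Definition induced_adj : rel {x : G | x \in A} :=
  fun u v => adj (val u) (val v).

Fact induced_sym : symmetric induced_adj.
Proof. by move=> u v; apply: adj_sym. Qed.

Fact induced_irr : irreflexive induced_adj.
Proof. by move=> u; apply: adj_irr. Qed.

Definition induced : sgraph := SGraph induced_sym induced_irr.

Definition extension_adj : rel (option G) := fun u v =>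
  match u, v with
  | Some x, Some y => adj x y
  | Some x, None | None, Some x => x \in A
  | None, None => false
  end.

Fact extension_sym : symmetric extension_adj.
Proof. by move=> [x|] [y|] //=; apply: adj_sym. Qed.

Fact extension_irr : irreflexive extension_adj.
Proof. by move=> [x|] //=; apply: adj_irr. Qed.

(* [None] is the new vertex. *)
Definition extension : sgraph := SGraph extension_sym extension_irr.

Definition complement_adj : rel G := fun x y => (x != y) && ~~ adj x y.

Fact complement_sym : symmetric complement_adj.
Proof. by move=> x y; rewrite /complement_adj eq_sym adj_sym. Qed.

Fact complement_irr : irreflexive complement_adj.
Proof. by move=> x; rewrite /complement_adj eqxx. Qed.

Definition complement : sgraph := SGraph complement_sym complement_irr.

End Constructions.

Definition unit_sphere (G : sgraph) (x : G) : sgraph :=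
  induced [set y | adj x y].

Definition remove (G : sgraph) (x : G) : sgraph := induced [set~ x].

Inductive contractible : sgraph -> Prop :=
| contractible_K1 (G : sgraph) : #|G| = 1 -> contractible G
| contractible_step (G : sgraph) (x : G) :
    contractible (unit_sphere x) -> contractible (remove x) -> contractible G.

(* Graphs are identified up to isomorphism: without [homotopic_iso] the vertex
   types themselves would matter. *)
Inductive homotopic : sgraph -> sgraph -> Prop :=
| homotopic_iso (G H : sgraph) : iso G H -> homotopic G H
| homotopic_extension (G : sgraph) (A : {set G}) :
    contractible (induced A) -> homotopic G (extension A)
| homotopic_reduction (G : sgraph) (x : G) :
    contractible (unit_sphere x) -> homotopic G (remove x)
| homotopic_trans (G H K : sgraph) :
    homotopic G H -> homotopic H K -> homotopic G K.

Inductive is_sphere : int -> sgraph -> Prop :=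
| is_sphere_empty (G : sgraph) : #|G| = 0 -> is_sphere (-1)%R G
| is_sphere_step (d : nat) (G : sgraph) :
    (forall x : G, is_sphere (d%:Z - 1)%R (unit_sphere x)) ->
    (exists x : G, contractible (remove x)) ->
    is_sphere d%:Z%R G.

Section PathGraph.
Variable n : nat.

Definition path_adj : rel 'I_n :=
  fun i j => (i.+1 == j :> nat) || (j.+1 == i :> nat).

Fact path_sym : symmetric path_adj.
Proof. by move=> i j; rewrite /path_adj orbC. Qed.

Fact path_irr : irreflexive path_adj.
Proof. by move=> i; rewrite /path_adj orbb eqn_leq ltnn. Qed.

Definition path_graph : sgraph := SGraph path_sym path_irr.

End PathGraph.

(* Main.v *)
Require Import Defs.
From mathcomp Require Import all_boot all_order all_algebra.

(** Write [G_n] for the complement of the path on [n] vertices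
    [0, ..., n - 1].  Everything rests on one relation: [G_(n + 3)] reduces to
    the suspension of [G_n].  Vertex [0] of [G_(n + 3)] is adjacent to
    every other vertex except [1], and [1] is not adjacent to [2]; hence [0]
    is a cone apex of the unit sphere of [2], which is therefore contractible
    ([apex_contractible], [sphere2_contractible]), and [2] may be removed.
    What is left is the non-adjacent pair [0, 1], each of which is adjacent to
    all of [3, ..., n + 2], together with a copy of [G_n] on those vertices:
    a suspension ([path_remove2_iso]).

    It remains to see what suspension preserves.  It keeps contractible graphs
    contractible ([susp_contractible]), because one pole has the base as its
    unit sphere and its removal leaves a cone.  It maps [d]-spheres to
    [(d + 1)]-spheres ([susp_sphere]), because a pole has the base as its unit
    sphere, and any other vertex has the suspension of its old unit sphere.  It
    maps homotopies to homotopies ([susp_homotopic]), because it commutes with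
    extensions and reductions.  By induction on [d] the three claims go back to
    [G_1], a single vertex, to [G_2], the suspension of the empty graph [G_0],
    and to [G_3], which reduces to that suspension. *)

Set Implicit Arguments.
Unset Strict Implicit.
Unset Printing Implicit Defensive.

Import GRing.Theory.

(** * Isomorphisms *)

(** All isomorphisms below compare graphs that sit inside a common ambient
    graph, so it suffices to compare the images of the two embeddings. *)
Lemma iso_embeddings (K H G : sgraph) (f : K -> G) (g : H -> G) :
  injective f -> injective g ->
  (forall x y, adj (f x) (f y) = adj x y) ->
  (forall x y, adj (g x) (g y) = adj x y) ->
  codom f =i codom g -> iso K H.
Proof.
move=> fI gI fadj gadj fg.
have fin x : f x \in codom g by rewrite -fg codom_f.
have gin y : g y \in codom f by rewrite fg codom_f.
exists (fun x => iinv (fin x)); last first.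
  by move=> x y; rewrite -gadj !f_iinv fadj.
exists (fun y => iinv (gin y)) => [x|y].
  by apply: fI; rewrite !f_iinv.
by apply: gI; rewrite !f_iinv.
Qed.

Lemma codom_val_induced (G : sgraph) (A : {set G}) (y : G) :
  (y \in codom (val : induced A -> G)) = (y \in A).
Proof.
apply/codomP/idP => [[u ->]|yA]; first exact: (valP u).
by exists (exist _ y yA : induced A).
Qed.

Lemma iso_induced_embedding (K G : sgraph) (A : {set G}) (f : K -> G) :
  injective f -> (forall x y, adj (f x) (f y) = adj x y) ->
  codom f =i A -> iso K (induced A).
Proof.
move=> fI fadj fA.
apply: (@iso_embeddings _ (induced A) G f val) => //; first exact: val_inj.
by move=> y; rewrite codom_val_induced fA.
Qed.

Lemma iso_sym (G H : sgraph) : iso G H -> iso H G.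
Proof.
case=> f [g fK gK] fadj; exists g; first by exists f.
by move=> x y; rewrite -fadj !gK.
Qed.

Lemma iso_induced (G H : sgraph) (f : G -> H) (A : {set G}) (B : {set H}) :
  bijective f -> (forall x y, adj (f x) (f y) = adj x y) ->
  (forall x, (f x \in B) = (x \in A)) -> iso (induced A) (induced B).
Proof.
move=> fbij fadj fAB.
apply: (@iso_induced_embedding (induced A) H B (f \o val)).
- by move=> u v /(bij_inj fbij) /val_inj.
- by move=> u v; rewrite /= fadj.
case: fbij => g fK gK y; apply/codomP/idP => [[u ->]|yB].
  by rewrite /= fAB (valP u).
have gyA : g y \in A by rewrite -fAB gK.
by exists (exist _ (g y) gyA : induced A); rewrite /= gK.
Qed.

Lemma iso_unit_sphere (G H : sgraph) (f : G -> H) (x : G) :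
  bijective f -> (forall x y, adj (f x) (f y) = adj x y) ->
  iso (unit_sphere x) (unit_sphere (f x)).
Proof. by move=> fbij fadj; apply: (iso_induced fbij) => // y; rewrite !inE. Qed.

Lemma iso_remove (G H : sgraph) (f : G -> H) (x : G) :
  bijective f -> (forall x y, adj (f x) (f y) = adj x y) ->
  iso (remove x) (remove (f x)).
Proof.
move=> fbij fadj; apply: (iso_induced fbij) => // y.
by rewrite !inE (inj_eq (bij_inj fbij)).
Qed.

Lemma contractible_iso (G H : sgraph) :
  iso G H -> contractible G -> contractible H.
Proof.
move=> GH cG; elim: cG H GH => {G} [G G1|G x _ IHs _ IHr] H [f fbij fadj].
  by apply: contractible_K1; rewrite -(bij_eq_card fbij).
apply: (@contractible_step _ (f x)).
  by apply: IHs; apply: iso_unit_sphere.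
by apply: IHr; apply: iso_remove.
Qed.

Lemma sphere_iso (k : int) (G H : sgraph) :
  iso G H -> is_sphere k G -> is_sphere k H.
Proof.
move=> GH sG; elim: sG H GH => {k G} [G G0|d G _ IH [x cx]] H [f fbij fadj].
  by apply: is_sphere_empty; rewrite -(bij_eq_card fbij).
apply: is_sphere_step; last first.
  by exists (f x); apply: contractible_iso cx; apply: iso_remove.
case: (fbij) => g fK gK y; apply: (IH (g y)).
by rewrite -{2}[y]gK; apply: iso_unit_sphere.
Qed.

(** * Suspensions *)

(** Deleting a vertex other than the apex, or passing to its unit sphere,
    leaves a smaller graph with the same apex. *)
Lemma apex_contractible (G : sgraph) (a : G) :
  (forall y, y != a -> adj a y) -> contractible G.
Proof.
have [n] := ubnP #|G|; elim: n G a => // n IH G a ltGn apex.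
have [x xa|all_a] := pickP (fun x => x != a); last first.
  by apply: contractible_K1; apply: (@eq_card1 _ a) => x; have /negbFE := all_a x.
have smaller (A : {set G}) : x \notin A -> #|induced A| < n.
  move=> xA; rewrite card_sig; apply: leq_trans (_ : #|G| <= n) => //.
  by apply/proper_card/properP; split; [apply/subsetP | exists x].
have sub (A : {set G}) : x \notin A -> a \in A -> contractible (induced A).
  move=> xA aA; apply: (IH _ (exist _ a aA : induced A)) (smaller A xA) _.
  by move=> y ya; apply: apex.
apply: (@contractible_step _ x); apply: sub; rewrite !inE ?adj_irr ?eqxx //.
  by rewrite adj_sym apex.
by rewrite eq_sym.
Qed.

(** The two poles are [Some None], the apex of a cone over [G], and [None],
    joined to everything except that apex. *)
Definition susp (G : sgraph) : sgraph :=
  @extension (@extension G [set: G]) [set~ None].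

Section Suspension.
Variable G : sgraph.

Definition base (x : G) : susp G := Some (Some x).
Definition south : susp G := Some None.
Definition north : susp G := None.

Lemma codom_base (u : susp G) :
  (u \in codom base) = if u is Some (Some _) then true else false.
Proof.
apply/codomP/idP => [[x ->] //|].
by case: u => [[x|]|] // _; exists x.
Qed.

Lemma iso_unit_sphere_pole (p : susp G) :
  p = north \/ p = south -> iso G (unit_sphere p).
Proof.
move=> pole; apply: (@iso_induced_embedding G _ _ base) => //.
  by move=> x y [].
move=> u; rewrite codom_base.
by case: pole => ->; case: u => [[x|]|]; rewrite !inE /= ?inE.
Qed.

Lemma remove_north_contractible : contractible (remove north).
Proof.
have sP : south \in [set~ north] by rewrite !inE.
apply: (@apex_contractible (remove north) (exist _ south sP)).
case=> [[[x|]|] uP]; rewrite -val_eqE /= /induced_adj /= ?inE //.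
by move: uP; rewrite !inE.
Qed.

Lemma susp_contractible : contractible G -> contractible (susp G).
Proof.
move=> cG; apply: (@contractible_step _ north) remove_north_contractible.
by apply: contractible_iso cG; apply: iso_unit_sphere_pole; left.
Qed.

(** The suspension of [induced A], seen as a set of vertices of [susp G]. *)
Definition susp_set (A : {set G}) : {set susp G} :=
  [set u : susp G | if u is Some (Some x) then x \in A else true].

Lemma iso_susp_induced (A : {set G}) :
  iso (susp (induced A)) (induced (susp_set A)).
Proof.
apply: (@iso_induced_embedding (susp (induced A)) (susp G) _ (omap (omap val))).
- by move=> [[x|]|] [[y|]|] //= [/val_inj ->].
- by move=> [[x|]|] [[y|]|]; rewrite //= ?inE.
move=> u; rewrite inE; apply/codomP/idP => [[[[x|]|] ->] //|].
  exact: (valP x).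
case: u => [[x|]|] => [xA||].
- by exists (Some (Some (exist _ x xA))).
- by exists (Some None).
by exists None.
Qed.

Lemma unit_sphere_base (x : G) :
  [set u | adj (base x) u] = susp_set [set y | adj x y].
Proof. by apply/setP=> [[[y|]|]]; rewrite !inE /= ?inE. Qed.

Lemma remove_base (x : G) : [set~ base x] = susp_set [set~ x].
Proof. by apply/setP=> [[[y|]|]]; rewrite !inE. Qed.

(** The two cases of [susp_sphere], the empty sphere and the [d]-spheres with
    [0 <= d], share this step: in the former the second hypothesis is vacuous,
    in the latter it is the induction hypothesis. *)
Lemma susp_sphere_step (d : nat) :
  is_sphere (d%:Z - 1)%R G ->
  (forall x : G, is_sphere (d%:Z - 1)%R (susp (unit_sphere x))) ->
  is_sphere d%:Z (susp G).
Proof.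
move=> sG sS; apply: is_sphere_step; last first.
  by exists north; apply: remove_north_contractible.
case=> [[x|]|].
- rewrite /unit_sphere (unit_sphere_base x).
  by apply: sphere_iso (sS x); apply: iso_susp_induced.
- by apply: sphere_iso sG; apply: iso_unit_sphere_pole; right.
by apply: sphere_iso sG; apply: iso_unit_sphere_pole; left.
Qed.

(** Only the order in which the new vertex and the poles are added differs;
    [susp_set A] contains both poles because the suspension joins them to the
    new vertex. *)
Lemma iso_susp_extension (A : {set G}) :
  iso (extension (susp_set A)) (susp (extension A)).
Proof.
pose f (u : extension (susp_set A)) : susp (extension A) :=
  match u with
  | Some (Some (Some x)) => Some (Some (Some x))
  | Some (Some None) => Some None
  | Some None => None
  | None => Some (Some None)
  end.
pose g (u : susp (extension A)) : extension (susp_set A) :=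
  match u with
  | Some (Some (Some x)) => Some (Some (Some x))
  | Some (Some None) => None
  | Some None => Some (Some None)
  | None => Some None
  end.
exists f; first by exists g; move=> [[[x|]|]|].
by move=> [[[x|]|]|] [[[y|]|]|]; rewrite /= ?inE.
Qed.

End Suspension.

Lemma iso_susp (G H : sgraph) : iso G H -> iso (susp G) (susp H).
Proof.
case=> f [g fK gK] fadj; exists (omap (omap f)).
  exists (omap (omap g)); first by move=> [[x|]|] //=; rewrite fK.
  by move=> [[x|]|] //=; rewrite gK.
by move=> [[x|]|] [[y|]|]; rewrite /= ?inE.
Qed.

Lemma susp_sphere (k : int) (G : sgraph) :
  is_sphere k G -> is_sphere (k + 1)%R (susp G).
Proof.
elim=> {k G} [G G0|d G sG IH cG].
  apply: (@susp_sphere_step _ 0); first exact: is_sphere_empty.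
  by move=> x; have := card0_eq G0 x; rewrite inE.
rewrite addrC -intS; apply: susp_sphere_step => [|x].
  by rewrite intS addrC addKr; apply: is_sphere_step.
by rewrite intS addrC addKr; have := IH x; rewrite subrK.
Qed.

Lemma susp_homotopic (G H : sgraph) :
  homotopic G H -> homotopic (susp G) (susp H).
Proof.
elim=> {G H} [G H GH|G A cA|G x cx|G H K _ GH _ HK].
- by apply: homotopic_iso; apply: iso_susp.
- apply: homotopic_trans (homotopic_iso (iso_susp_extension A)).
  apply: homotopic_extension.
  by apply: contractible_iso (susp_contractible cA); apply: iso_susp_induced.
- apply: (@homotopic_trans _ (remove (base x))).
    apply: homotopic_reduction; rewrite /unit_sphere unit_sphere_base.
    by apply: contractible_iso (susp_contractible cx); apply: iso_susp_induced.
  apply: homotopic_iso; rewrite /remove remove_base; apply: iso_sym.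
  exact: iso_susp_induced.
exact: homotopic_trans GH HK.
Qed.

(** * Complements of paths *)

Notation copath n := (complement (path_graph n)).

Section ThreeMoreVertices.
Variable n : nat.

Let v2 : copath n.+3 := @Ordinal n.+3 2 isT.

Lemma sphere2_contractible : contractible (unit_sphere v2).
Proof.
have aP : (ord0 : copath n.+3) \in [set y | adj v2 y] by rewrite inE.
apply: (@apex_contractible (unit_sphere v2)
  (exist (fun y => y \in [set z | adj v2 z]) _ aP)).
case=> [[[|[|m]] ltm] mP]; rewrite -val_eqE //=.
(* Vertex 1, the only non-neighbour of 0, is not in the unit sphere of 2. *)
by move: mP; rewrite inE.
Qed.

Lemma path_remove2_iso : iso (remove v2) (susp (copath n)).
Proof.
pose f (u : susp (copath n)) : copath n.+3 :=
  match u with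
  | None => ord0
  | Some None => @Ordinal n.+3 1 isT
  | Some (Some i) => rshift 3 i
  end.
apply: iso_sym; apply: (@iso_induced_embedding (susp (copath n)) _ _ f).
- by move=> [[x|]|] [[y|]|] //= [] /val_inj ->.
- by move=> [[x|]|] [[y|]|]; rewrite /= ?inE.
move=> i; rewrite !inE; apply/codomP/idP => [[[[x|]|] ->] //|].
case: i => [[|[|[|m]]] ltm] //= _.
- by exists None; apply: val_inj.
- by exists (Some None); apply: val_inj.
have ltmn : m < n by [].
by exists (Some (Some (Ordinal ltmn))); apply: val_inj.
Qed.

Lemma copath_susp : homotopic (copath n.+3) (susp (copath n)).
Proof.
exact: homotopic_trans (homotopic_reduction sphere2_contractible)
  (homotopic_iso path_remove2_iso).
Qed.

(** Being homotopic to a contractible graph would not be enough here: the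
    inductive notion allows vertex removals only.  Here the homotopy from
    [copath n.+3] to the suspension is itself a removal. *)
Lemma copath_contractible : contractible (copath n) -> contractible (copath n.+3).
Proof.
move=> cn; apply: contractible_step sphere2_contractible _.
exact: contractible_iso (iso_sym path_remove2_iso) (susp_contractible cn).
Qed.

End ThreeMoreVertices.

Lemma copath2_iso : iso (copath 2) (susp (copath 0)).
Proof.
pose f (u : susp (copath 0)) : copath 2 := if u is None then ord0 else ord_max.
apply: (@iso_embeddings _ _ (copath 2) id f) => //.
- by move=> [[[[|m] //]|]|] [[[[|k] //]|]|].
- by move=> [[[[|m] //]|]|] [[[[|k] //]|]|]; rewrite /= ?inE.
move=> i; rewrite codom_f; symmetry; apply/codomP.
case: i => [[|[|//]] lti]; first by exists None; apply: val_inj.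
by exists (Some None); apply: val_inj.
Qed.

Lemma copath0_susp_sphere : is_sphere 0 (susp (copath 0)).
Proof. by apply: (@susp_sphere (-1)); apply: is_sphere_empty; rewrite card_ord. Qed.

Lemma copath_sphere_step (d n : nat) :
  (exists S : sgraph, is_sphere d%:Z S /\ homotopic (copath n) S) ->
  exists S : sgraph, is_sphere d.+1%:Z S /\ homotopic (copath n.+3) S.
Proof.
case=> S [sS nS]; exists (susp S); split.
  by rewrite intS addrC; apply: susp_sphere.
exact: homotopic_trans (copath_susp n) (susp_homotopic nS).
Qed.

Theorem theorem3 (d : nat) :
  contractible (complement (path_graph (3 * d + 1))) /\
  (exists S : sgraph,
     is_sphere d%:Z S /\ homotopic (complement (path_graph (3 * d + 2))) S) /\
  (exists S : sgraph,
     is_sphere d%:Z S /\ homotopic (complement (path_graph (3 * d + 3))) S).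
Proof.
elim: d => [|d [IH1 [IH2 IH3]]].
  split; first by apply: contractible_K1; rewrite card_ord.
  split; exists (susp (copath 0)); split; try exact: copath0_susp_sphere.
    exact: homotopic_iso copath2_iso.
  exact: copath_susp.
rewrite mulnS; split; first exact: copath_contractible.
by split; apply: copath_sphere_step.
Qed.
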